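(* Assume that $\mathrm{avg}(i,j)$ can be evaluated in $O(1)$ time for any $1\le i<j\le n+1$. Then Algorithm 2 can be implemented to run in $O(n\log n)$ time on any instance of Problem (P) with $n$ variables.
   Context: Problem (P): given an integer $n\ge1$, reals $0<q_1\le\cdots\le q_n$, $z_1,\dots,z_n>0$ and $K>0$, maximize $\sum_{i=1}^n x_i$ subject to $0\le x_i\le q_i$, $0\le x_1\le\cdots\le x_n$, $\sum_{i=1}^n z_ix_i\le K$. For $1\le i<j\le n+1$ let $\mathrm{sum}(i,j)=z_i+\cdots+z_{j-1}$ and $\mathrm{avg}(i,j)=\mathrm{sum}(i,j)/(j-i)$. (In the motivating instance, $z_i=(n-i)(1/q_i-1/q_{i+1})+1/q_i$ for $i<n$ and $z_n=1/q_n$, so $\mathrm{sum}(i,j)=(n-i+1)/q_i-(n-j+1)/q_j$ for $j\le n$ and $\mathrm{sum}(i,n+1)=(n-i+1)/q_i$.) Algorithm 2: Set $S=\{0,n+1\}$, $b_n=n+1$, $y_n=z_n$, $x_n=0$. For $i=n-1$ down to $1$: set $b_i=i+1$; while $b_i\ne n+1$ and $\mathrm{avg}(i,b_i)\le\mathrm{avg}(b_i,b_{b_i})$, set $b_i\leftarrow b_{b_i}$; then set $y_i=\mathrm{avg}(i,b_i)$ and $x_i=0$. Set $\hat B=K$. While $\hat B>0$ and $S\ne\{0,1,\dots,n+1\}$: let $i^*$ be the index $i\in\{1,\dots,n\}\setminus S$ minimizing $y_i$, ties broken in favour of the smallest index; set $d=\min\{\hat B/((b_{i^*}-i^* )y_{i^*}),\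 q_{i^*}-x_{i^*}\}$; set $\hat B\leftarrow\hat B-d(b_{i^*}-i^* )y_{i^*}$; add $d$ to $x_i$ for all $i^*\le i<b_{i^*}$; add $i^*$ to $S$. Output $x_1,\dots,x_n$. *)

(* Defs.v *)
From HB Require Import structures.
From mathcomp Require Import all_boot all_order all_algebra.
From mathcomp Require Import reals.
Set Implicit Arguments. Unset Strict Implicit. Unset Printing Implicit Defensive.
Import Order.TTheory GRing.Theory Num.Theory.
Local Open Scope ring_scope.

Section Problem.
Variable R : realFieldType.
(* An instance: n, q, z (only indices 1..n are meaningful), K. *)
Variables (n : nat) (q z : nat -> R) (K : R).

Definition zsum (i j : nat) : R := \sum_(i <= k < j) z k.
Definition zavg (i j : nat) : R := zsum i j / (j - i)%:R.

Definition upd (b : nat -> nat) (i v : nat) : nat -> nat :=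
  fun j => if j == i then v else b j.

(* inner while loop "while b_i <> n+1 and avg(i,b_i) <= avg(b_i,b_{b_i}):
   b_i <- b_{b_i}"; the fuel n is never exhausted since b_i strictly
   increases and stays <= n+1. *)
Fixpoint jump (fuel : nat) (b : nat -> nat) (i c : nat) : nat :=
  if fuel is f.+1 then
    if (c != n.+1) && (zavg i c <= zavg c (b c)) then jump f b i (b c) else c
  else c.

Fixpoint phase1 (k : nat) : nat -> nat :=
  if k is k'.+1 then
    let b := phase1 k' in
    let i := (n - k)%N in
    if (1 <= i)%N then upd b i (jump n b i i.+1) else b
  else fun _ => n.+1.

Definition alg2_b : nat -> nat := phase1 n.-1.
Definition alg2_y (i : nat) : R := zavg i (alg2_b i).

Definition argmin_y (S : nat -> bool) : option nat :=
  match [seq i <- iota 1 n | ~~ S i] with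
  | [::] => None
  | h :: t => Some (foldl (fun a i => if alg2_y i < alg2_y a then i else a) h t)
  end.

Fixpoint phase2 (fuel : nat) (B : R) (S : nat -> bool) (x : nat -> R)
  : nat -> R :=
  if fuel is f.+1 then
    if 0 < B then
      match argmin_y S with
      | None => x
      | Some ist =>
        let bi := alg2_b ist in
        let w := (bi - ist)%:R * alg2_y ist in
        let d := Num.min (B / w) (q ist - x ist) in
        phase2 f (B - d * w) (fun j => S j || (j == ist))
               (fun j => if (ist <= j < bi)%N then x j + d else x j)
      end
    else x
  else x.

(* Output of Algorithm 2: x_i for 1 <= i <= n.  S starts as {0, n+1};
   the loop runs at most n times, so fuel n suffices. *)
Definition alg2 : nat -> R :=
  phase2 n K (fun j => (j == 0)%N || (j == n.+1)) (fun _ => 0).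

End Problem.

(** * Cost model: a simple imperative RAM with natural-number memory and
    real-number memory.  Each executed atomic command and each evaluation
    of an if/while test costs one unit.  Natural-number operations are
    +, truncated -, halving; real operations are +, -, *, / and comparisons;
    inputs are read by unit-cost primitives for n, q_i, K and the oracle
    avg(i,j).  There ist no conversion from reals to naturals. *)
Inductive nexp :=
| NConst of nat | NSize | NLoad of nexp
| NAdd of nexp & nexp | NSub of nexp & nexp | NHalf of nexp.

Inductive rexp :=
| RZero | ROne | RLoad of nexp
| RAdd of rexp & rexp | RSub of rexp & rexp | RMul of rexp & rexp
| RDiv of rexp & rexp
| RQ of nexp | RK | RAvg of nexp & nexp.

Inductive bexp :=
| BTrue | BNot of bexp | BAnd of bexp & bexp
| BNle of nexp & nexp | BRle of rexp & rexp | BRlt of rexp & rexp.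

Inductive cmd :=
| Skip | NStore of nexp & nexp | RStore of nexp & rexp
| Seq of cmd & cmd | If of bexp & cmd & cmd | While of bexp & cmd.

Record state (R : Type) := State { nmem : nat -> nat; rmem : nat -> R }.

Section Semantics.
Variable R : realFieldType.
Variables (n : nat) (q z : nat -> R) (K : R).

Fixpoint neval (m : nat -> nat) (e : nexp) : nat :=
  match e with
  | NConst k => k
  | NSize => n
  | NLoad a => m (neval m a)
  | NAdd a b => (neval m a + neval m b)%N
  | NSub a b => (neval m a - neval m b)%N
  | NHalf a => (neval m a)./2
  end.

Fixpoint reval (st : state R) (e : rexp) : R :=
  match e with
  | RZero => 0
  | ROne => 1
  | RLoad a => rmem st (neval (nmem st) a)
  | RAdd a b => reval st a + reval st b
  | RSub a b => reval st a - reval st b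
  | RMul a b => reval st a * reval st b
  | RDiv a b => reval st a / reval st b
  | RQ i => q (neval (nmem st) i)
  | RK => K
  | RAvg i j => zavg z (neval (nmem st) i) (neval (nmem st) j)
  end.

Fixpoint beval (st : state R) (e : bexp) : bool :=
  match e with
  | BTrue => true
  | BNot a => ~~ beval st a
  | BAnd a b => beval st a && beval st b
  | BNle a b => (neval (nmem st) a <= neval (nmem st) b)%N
  | BRle a b => reval st a <= reval st b
  | BRlt a b => reval st a < reval st b
  end.

Definition nupd (f : nat -> nat) (a v : nat) := fun j => if j == a then v else f j.
Definition rupd (f : nat -> R) (a : nat) (v : R) :=
  fun j => if j == a then v else f j.

Inductive exec : state R -> cmd -> nat -> state R -> Prop :=
| ESkip st : exec st Skip 1 st
| ENStore st a v :
    exec st (NStore a v) 1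
      (State (nupd (nmem st) (neval (nmem st) a) (neval (nmem st) v)) (rmem st))
| ERStore st a v :
    exec st (RStore a v) 1
      (State (nmem st) (rupd (rmem st) (neval (nmem st) a) (reval st v)))
| ESeq st c1 c2 k1 k2 st1 st2 :
    exec st c1 k1 st1 -> exec st1 c2 k2 st2 -> exec st (Seq c1 c2) (k1 + k2) st2
| EIfT st b c1 c2 k st' :
    beval st b -> exec st c1 k st' -> exec st (If b c1 c2) k.+1 st'
| EIfF st b c1 c2 k st' :
    ~~ beval st b -> exec st c2 k st' -> exec st (If b c1 c2) k.+1 st'
| EWhileF st b c : ~~ beval st b -> exec st (While b c) 1 st
| EWhileT st b c k1 k2 st1 st2 :
    beval st b -> exec st c k1 st1 -> exec st1 (While b c) k2 st2 ->
    exec st (While b c) (k1 + k2).+1 st2.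

End Semantics.

Definition init_state (R : Type) (r0 : R) : state R :=
  State (fun _ => 0%N) (fun _ => r0).

(* Main.v *)
Require Import Defs.
From HB Require Import structures.
From mathcomp Require Import all_boot all_order all_algebra.
From mathcomp Require Import reals.
From mathcomp Require Import zify.
Set Implicit Arguments. Unset Strict Implicit. Unset Printing Implicit Defensive.
Import Order.TTheory GRing.Theory Num.Theory.
Local Open Scope ring_scope.

(* The intervals [i, b_i) are nested, and y_i <= y_k whenever i <= k < b_i.  With
   ties broken towards small indices, Algorithm 2 therefore selects an index only
   after all intervals containing it; so x_j is changed for the last time when j is
   selected, and until then it equals the value of its parent p(j), the largest
   k < j with j < b_k (0 if there is none).  Hence the range update can be replaced
   by the single assignment x_j := x_{p(j)} + d.  The pointers b are computed by
   following chains i+1, b_{i+1}, ..., n+1, and the length of the current chain is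
   the potential that makes this linear.  Indices are selected in order of (y, i)
   by a tournament tree, in O(log n) steps each. *)

(** * Structure of the intervals and choice of the minimum *)

Section Structure.
Variables (R : realFieldType) (n : nat) (z : nat -> R).

Let b := alg2_b n z.
Let y := alg2_y n z.

Lemma zsum_cat {i c d : nat} : (i <= c <= d)%N ->
  zsum z i d = zsum z i c + zsum z c d.
Proof. by move=> /andP[? ?]; rewrite /zsum (@big_cat_nat _ _ _ c). Qed.

(** The average over [[i, d)] is a convex combination of those over [[i, c)] and [[c, d)], hence at
    most the larger one. *)
Lemma zavg_merge {i c d : nat} : (i < c < d)%N ->
  zavg z i c <= zavg z c d -> zavg z i d <= zavg z c d.
Proof.
move=> /andP[ic cd]; rewrite /zavg (@zsum_cat i c d); last lia.
have -> : ((d - i)%:R : R) = (c - i)%:R + (d - c)%:R.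
  by rewrite -natrD; congr _%:R; lia.
have m_gt0 : 0 < ((c - i)%:R : R) by rewrite ltr0n subn_gt0.
have k_gt0 : 0 < ((d - c)%:R : R) by rewrite ltr0n subn_gt0.
move: m_gt0 k_gt0; move: (_%:R) (_%:R) => m k m_gt0 k_gt0.
rewrite ler_pdivrMr // mulrAC ler_pdivlMr // => le_ab.
rewrite ler_pdivrMr ?addr_gt0 // mulrAC ler_pdivlMr //.
by rewrite mulrDl mulrDr lerD2r.
Qed.

Lemma jump_eq (b1 b2 : nat -> nat) (i f c : nat) :
  (forall j, (i < j)%N -> b1 j = b2 j) ->
  (forall j, (i < j)%N -> (i < b1 j)%N) ->
  (i < c)%N -> jump n z f b1 i c = jump n z f b2 i c.
Proof.
move=> eq_b gt_b; elim: f c => //= f IH c ic.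
by rewrite -(eq_b c ic) (IH (b1 c)) ?gt_b.
Qed.

Lemma jump_bounds (b1 : nat -> nat) (i f c : nat) :
  (forall j, (i < j <= n)%N -> (j < b1 j <= n.+1)%N) ->
  (i < c <= n.+1)%N -> (i < jump n z f b1 i c <= n.+1)%N.
Proof.
move=> bP; elim: f c => //= f IH c cP; case: ifP => // /andP[cn _].
by apply: IH; have := bP c; lia.
Qed.

Lemma jump_last b1 i f : jump n z f b1 i n.+1 = n.+1.
Proof. by case: f => //= f; rewrite eqxx. Qed.

(** Step [k] writes at most entry [n - k], so entry [j] is final after step [n - j]. *)
Lemma phase1_stable {k j : nat} : (n - j <= k)%N ->
  phase1 n z k j = phase1 n z (n - j) j.
Proof.
move=> /subnKC <-; elim: (k - _)%N => [|d IH]; first by rewrite addn0.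
rewrite addnS /= -IH; case: ifP => // ?; rewrite /upd; case: eqP => //; lia.
Qed.

Lemma alg2_b_stable {k j : nat} : (0 < j)%N -> (n - j <= k)%N ->
  phase1 n z k j = b j.
Proof. by move=> j0 jk; rewrite phase1_stable // /b /alg2_b phase1_stable; lia. Qed.

Lemma alg2_b_out j : (n <= j)%N -> (0 < j)%N -> b j = n.+1.
Proof. by move=> nj j0; rewrite -(@alg2_b_stable 0) //; lia. Qed.

(** [jump] from [i] reads only pointers of indices above [i], which are final by then; so [b]
    satisfies its own recursion. *)
Lemma alg2_bP {i} : (0 < i <= n)%N ->
  (i < b i <= n.+1)%N /\ b i = jump n z n b i i.+1.
Proof.
have [m] := ubnP (n - i); elim: m i => // m IH i mP iP.
have [i_n|i_n] := eqVneq i n.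
  rewrite alg2_b_out; [|lia..]; split; first lia.
  by rewrite i_n jump_last.
have [k kE] : exists k, (n - i)%N = k.+1 by exists (n - i).-1; lia.
have bgt j : (i < j <= n)%N -> (j < b j <= n.+1)%N.
  by move=> jP; apply: (IH j _ _).1; lia.
have b_i : b i = jump n z n b i i.+1.
  rewrite -(@alg2_b_stable (n - i)) //; last lia.
  rewrite kE /=; have -> : (n - k.+1)%N = i by lia.
  rewrite (_ : (1 <= i)%N = true) ?/upd ?eqxx; last lia.
  apply: jump_eq => // j ij; first by rewrite alg2_b_stable //; lia.
  rewrite alg2_b_stable; [|lia..].
  have [jn|nj] := leqP j n; first by have := bgt j; lia.
  by rewrite alg2_b_out; lia.
by split=> //; rewrite b_i; apply: jump_bounds => //; lia.
Qed.

(* The chain [i+1, b (i+1), ...] has decreasing averages, so absorbing its next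
   element [c] keeps the average from [i] below that of every index absorbed so
   far. *)
Lemma alg2_nested {i} : (0 < i <= n)%N ->
  (forall k, (i <= k < b i)%N -> (b k <= b i)%N /\ y i <= y k) /\
  ((b i <= n)%N -> y (b i) < y i).
Proof.
have [m] := ubnP (n - i); elim: m i => // m IH i mP iP.
have {}IH j : (i < j <= n)%N ->
    (forall k, (j <= k < b j)%N -> (b k <= b j)%N /\ y j <= y k) /\
    ((b j <= n)%N -> y (b j) < y j) by move=> jP; apply: IH; lia.
(* The inner loop from any candidate [c]. The fuel [f] suffices, since each jump increases [c],
   which never exceeds [n.+1]. *)
suff H f c : (i < c <= n.+1)%N -> (n.+1 <= f + c)%N ->
    (forall k, (i < k < c)%N ->
       [/\ (b k <= c)%N, zavg z i c <= y k & (c <= n)%N -> y c <= y k]) ->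
    let c' := jump n z f b i c in
    (forall k, (i < k < c')%N -> (b k <= c')%N /\ zavg z i c' <= y k) /\
    ((c' <= n)%N -> y c' < zavg z i c').
  have := H n i.+1; rewrite /= -(alg2_bP iP).2.
  case; [lia|lia|by move=> k; lia|move=> H1 H2; split=> // k kP].
  have [->|ki] := eqVneq k i; first by [].
  by apply: H1; lia.
elim: f c => [|f IHf] c cP fc Hc /=.
  by split=> [k /Hc[]//|]; lia.
case: ifP => [/andP[cn le_c]|test].
  have cP' : (i < c <= n)%N by lia.
  have [IH1 IH2] := IH c cP'.
  have [bc _] : (c < b c <= n.+1)%N /\ b c = jump n z n b c c.+1.
    by apply: alg2_bP; lia.
  apply: IHf; [lia|lia|] => k kP.
  have yc : zavg z i (b c) <= y c by apply: zavg_merge => //; lia.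
  have [kc|ck] := ltnP k c.
    have [|bk _ yk] := Hc k; first lia.
    split; [lia| |].
      by apply: le_trans yc _; apply: yk; lia.
    by move=> /IH2 lt_y; apply: le_trans (ltW lt_y) _; apply: yk; lia.
  have [|bk yk] := IH1 k; first lia.
  split=> //; first exact: le_trans yc yk.
  by move=> /IH2 lt_y; apply: le_trans (ltW lt_y) _.
split=> [k /Hc[]//|cn]; move: test; rewrite (_ : c != n.+1) /=; last lia.
by move/negbT; rewrite -ltNge.
Qed.

End Structure.

(** * The order in which indices are selected *)

Section Argmin.
Variables (R : realFieldType) (n : nat) (z : nat -> R).

(** Lexicographic order on the pairs [(y i, i)]. *)
Definition lexle (y : nat -> R) (i j : nat) : bool :=
  (y i <= y j) && ((y j <= y i) ==> (i <= j)%N).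

Lemma lexle_refl y i : lexle y i i.
Proof. by rewrite /lexle lexx leqnn. Qed.

Lemma lexle_anti y i j : lexle y i j -> lexle y j i -> i = j.
Proof.
move=> /andP[yij /implyP ij] /andP[yji /implyP ji].
by have := ij yji; have := ji yij; lia.
Qed.

Lemma lexle_trans y : transitive (lexle y).
Proof.
move=> j i k /andP[yij /implyP ij] /andP[yjk /implyP jk]; apply/andP; split.
  exact: le_trans yij yjk.
apply/implyP => yki; apply: (leq_trans (ij _) (jk _)).
  exact: le_trans yki.
exact: le_trans yij.
Qed.

Lemma lexle_total y i j : ~~ lexle y i j -> lexle y j i.
Proof.
rewrite /lexle negb_and negb_imply -ltNge => /orP[ji|/andP[-> ji]] /=.
  by rewrite (ltW ji) leNgt ji.
by apply/implyP => _; lia.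
Qed.

(** The list is increasing, so replacing the candidate only on strict improvement keeps the smaller
    index on ties. *)
Lemma lex_foldl (y : nat -> R) (a : nat) (s : seq nat) : path ltn a s ->
  let m := foldl (fun a i => if y i < y a then i else a) a s in
  m \in a :: s /\ {in a :: s, forall j, lexle y m j}.
Proof.
elim: s a => [|i s IH] a /=.
  by move=> _; split=> [|j]; rewrite ?mem_head // inE => /eqP->; apply: lexle_refl.
move=> /andP[ai si].
case: ltP => y_ia.
  have [mP mle] := IH i si; split; first by rewrite inE mP orbT.
  move=> j; rewrite inE => /orP[/eqP->|]; last exact: mle.
  apply: lexle_trans (mle i (mem_head _ _)) _.
  by rewrite /lexle (ltW y_ia) leNgt y_ia.
have sa : path ltn a s.
  by case: (s) si => //= k s' /andP[ik ->]; rewrite (ltn_trans ai ik).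
have [mP mle] := IH a sa; split.
  by move: mP; rewrite !inE => /orP[->//|->]; rewrite !orbT.
move=> j; rewrite !inE => /or3P[/eqP->|/eqP->|js].
- exact: mle (mem_head _ _).
- apply: lexle_trans (mle a (mem_head _ _)) _.
  by rewrite /lexle y_ia (ltnW ai) implybT.
- by apply: mle; rewrite inE js orbT.
Qed.

Definition live (S : nat -> bool) := [seq i <- iota 1 n | ~~ S i].

Lemma mem_live S i : (i \in live S) = [&& ~~ S i & (0 < i <= n)%N].
Proof. by rewrite mem_filter mem_iota add1n ltnS. Qed.

Lemma size_live_remove S m : m \in live S ->
  (size (live (fun j => S j || (j == m))) < size (live S))%N.
Proof.
move=> mS; rewrite -(count_predC (pred1 m) (live S)) -[ltnLHS]addn0 addnC.
rewrite /live (eq_filter (a2 := predI (predC1 m) (fun i => ~~ S i))).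
  rewrite filter_predI size_filter -addSn leq_add // -has_count has_pred1.
  exact: mS.
by move=> j /=; rewrite negb_or andbC.
Qed.

(** By antisymmetry the least element is unique; this identifies the winner of the tournament with
    the index chosen by the fold. *)
Lemma argmin_yP S m : m \in live S ->
  {in live S, forall j, lexle (alg2_y n z) m j} -> argmin_y n z S = Some m.
Proof.
move=> mS mle; rewrite /argmin_y -/(live S).
have: sorted ltn (live S) by apply/sorted_filter/iota_ltn_sorted/ltn_trans.
case: (live S) mS mle => // h s mS mle /lex_foldl /= /(_ (alg2_y n z))[aS ale].
by congr Some; apply: lexle_anti (ale _ mS) (mle _ aS).
Qed.

Lemma argmin_y_None S : live S = [::] -> argmin_y n z S = None.
Proof. by rewrite /argmin_y -/(live S) => ->. Qed.

End Argmin.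

(** * Weakest preconditions with costs *)

(* Natural-number memory holds four interleaved arrays: cell [j] of array [c < 4]
   is at address [4 j + c].  Array 0 holds the scalar variables, 1 the pointers
   [b], 2 the parents, 3 the tournament tree: node [u < n] has children [2 u] and
   [2 u + 1], index [j] is leaf [n + j - 1], and entry 0 means that no index is
   left. *)
Definition cell (c j : nat) : nat := (j + j + (j + j) + c)%N.
Definition ncell (c : nat) (e : nexp) : nexp :=
  NAdd (NAdd (NAdd e e) (NAdd e e)) (NConst c).
Definition ld (c : nat) (e : nexp) : nexp := NLoad (ncell c e).
Definition var (k : nat) : nexp := ld 0 (NConst k).
Definition setvar (k : nat) (e : nexp) : cmd := NStore (ncell 0 (NConst k)) e.

(** An address modulo 4 is the array number and its quotient the index, so distinct cells never
    collide. *)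
Lemma nupd_cell f c i v c' j : (c < 4)%N -> (c' < 4)%N ->
  nupd f (cell c i) v (cell c' j) = if (c' == c) && (j == i) then v else f (cell c' j).
Proof.
move=> c4 c'4; rewrite /nupd; congr (if _ then _ else _).
by rewrite /cell; apply/idP/idP; lia.
Qed.

Section WeakestPrecondition.
Variables (R : realFieldType) (n : nat) (q z : nat -> R) (K : R).

(** [exec] is inductive, so a derivation includes termination; [Q] also receives the cost, so
    correctness and running time are proved together. *)
Definition wp (c : cmd) (Q : state R -> nat -> Prop) (st : state R) : Prop :=
  exists st' k, exec n q z K st c k st' /\ Q st' k.

Lemma wp_weaken {c st} {Q1 Q2 : state R -> nat -> Prop} :
  wp c Q1 st -> (forall st' k, Q1 st' k -> Q2 st' k) -> wp c Q2 st.
Proof. by move=> [st' [k [ex Q1s]]] H; exists st', k; split=> //; apply: H. Qed.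

Lemma wp_nstore a v (Q : state R -> nat -> Prop) st :
  Q (State (nupd (nmem st) (neval n (nmem st) a) (neval n (nmem st) v)) (rmem st))
    1%N ->
  wp (NStore a v) Q st.
Proof. by move=> Qs; do 2!eexists; split; first exact: ENStore. Qed.

Lemma wp_rstore a v (Q : state R -> nat -> Prop) st :
  Q (State (nmem st)
       (rupd (rmem st) (neval n (nmem st) a) (reval n q z K st v))) 1%N ->
  wp (RStore a v) Q st.
Proof. by move=> Qs; do 2!eexists; split; first exact: ERStore. Qed.

Lemma wp_seq c1 c2 (Q : state R -> nat -> Prop) st :
  wp c1 (fun st1 k1 => wp c2 (fun st2 k2 => Q st2 (k1 + k2)%N) st1) st ->
  wp (Seq c1 c2) Q st.
Proof.
move=> [st1 [k1 [ex1 [st2 [k2 [ex2 Qs]]]]]].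
by exists st2, (k1 + k2)%N; split=> //; apply: ESeq ex1 ex2.
Qed.

Lemma wp_if b c1 c2 (Q : state R -> nat -> Prop) st :
  (beval n q z K st b -> wp c1 (fun st' k => Q st' k.+1) st) ->
  (~~ beval n q z K st b -> wp c2 (fun st' k => Q st' k.+1) st) ->
  wp (If b c1 c2) Q st.
Proof.
move=> H1 H2; have [bT|bF] := boolP (beval n q z K st b).
  have [st' [k [ex Qs]]] := H1 bT.
  by exists st', k.+1; split=> //; apply: EIfT.
have [st' [k [ex Qs]]] := H2 bF.
by exists st', k.+1; split=> //; apply: EIfF.
Qed.

(* The second argument of the invariant is a potential paying for the
   remaining iterations. *)
Lemma wp_while (I : state R -> nat -> Prop) b c Q st e :
  (forall st e, I st e -> beval n q z K st b ->
     wp c (fun st' k => exists e', I st' e' /\ (k + e' < e)%N) st) ->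
  I st e ->
  (forall st' e' k, I st' e' -> ~~ beval n q z K st' b -> (k + e' <= e.+1)%N ->
     Q st' k) ->
  wp (While b c) Q st.
Proof.
move=> Hstep; elim/ltn_ind: e st Q => e IH st Q Ise HQ.
have [bT|bF] := boolP (beval n q z K st b); last first.
  by exists st, 1%N; split; [apply: EWhileF|apply: (HQ _ e)].
have [st1 [k1 [ex1 [e1 [I1 le1]]]]] := Hstep _ _ Ise bT.
have [||st2 [k2 [ex2 [e2 [I2 b2 le2]]]]] := IH e1 _ st1
  (fun st' k => exists e', [/\ I st' e', ~~ beval n q z K st' b & (k + e' <= e1.+1)%N])
  I1; [lia|by move=> s e' k; exists e'|].
exists st2, (k1 + k2).+1; split; first exact: EWhileT ex1 ex2.
by apply: (HQ _ e2) => //; lia.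
Qed.

End WeakestPrecondition.

Arguments wp {R n q z K}.
Arguments wp_while {R n q z K}.

Lemma neval_ld n m c e : neval n m (ld c e) = m (cell c (neval n m e)).
Proof. by []. Qed.

Lemma neval_ncell n m c e : neval n m (ncell c e) = cell c (neval n m e).
Proof. by []. Qed.

Opaque cell ncell ld.

(** * Tournament tree *)

Definition nonzero (e : nexp) : bexp := BNle (NConst 1) e.
Definition yexp (e : nexp) : rexp := RAvg e (ld 1 e).

(* Real memory: cell 0 stays 0 and serves as the value of a missing parent, cells
   [1..n] hold [x], [n+1] the budget, [n+2] the increment [d] and [n+2+i] the length
   [b i - i], computed along with [b i] since naturals cannot be converted to
   reals. *)
Definition len_cell (e : nexp) : nexp := NAdd (NAdd NSize (NConst 2)) e.

(* Variables: 0 is the index of the main loop of the first phase, 1 the candidate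
   pointer of its inner loop, 2 a tree node and 3 the index [i*]. *)

Definition left_child : nexp := NAdd (var 2) (var 2).
Definition right_child : nexp := NAdd left_child (NConst 1).

Definition lex_ltb (d e : nexp) : bexp :=
  BAnd (BRle (yexp d) (yexp e))
       (BNot (BAnd (BRle (yexp e) (yexp d)) (BNle e d))).

Definition play : cmd :=
  If (BAnd (nonzero (ld 3 left_child))
        (BNot (BAnd (nonzero (ld 3 right_child))
                    (lex_ltb (ld 3 right_child) (ld 3 left_child)))))
     (NStore (ncell 3 (var 2)) (ld 3 left_child))
     (NStore (ncell 3 (var 2)) (ld 3 right_child)).

Section Tournament.
Variables (R : realFieldType) (n : nat).

(** Outcome of a match, where 0 is a missing player that loses to every index. *)
Definition best (y : nat -> R) (i j : nat) : nat :=
  if (0 < i)%N && ~~ ((0 < j)%N && ~~ lexle y i j) then i else j.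

Definition node_ok (y : nat -> R) (t : nat -> nat) (u : nat) : Prop :=
  t u = best y (t (u + u)%N) (t (u + u + 1)%N).

Lemma best_left y i j : (0 < i)%N -> (0 < best y i j)%N /\ lexle y (best y i j) i.
Proof.
rewrite /best => i0; rewrite i0 /=; case: ifP => [_|/negbFE/andP[-> /lexle_total]//].
by split=> //; apply: lexle_refl.
Qed.

Lemma best_right y i j : (0 < j)%N -> (0 < best y i j)%N /\ lexle y (best y i j) j.
Proof.
rewrite /best => j0; rewrite j0 /=.
case: ifP => [/andP[i0 /negbNE ij]//|_].
by split=> //; apply: lexle_refl.
Qed.

(** Every entry stems from a leaf, by induction from the leaves upwards, and along the path [u],
    [u./2], ... to the root entries never get worse. As [u./2] is the parent of every [u >= 2], [n]
    may be any positive number. *)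
Lemma tournament_winner (y : nat -> R) (t : nat -> nat) (P : pred nat) :
  (0 < n)%N ->
  (forall u, (0 < u < n)%N -> node_ok y t u) ->
  (forall j, (0 < j <= n)%N -> t (n + j - 1)%N = if P j then j else 0%N) ->
  (t 1%N = 0%N /\ forall j, (0 < j <= n)%N -> ~~ P j) \/
  [/\ (0 < t 1%N <= n)%N, P (t 1%N) &
      forall j, (0 < j <= n)%N -> P j -> lexle y (t 1%N) j].
Proof.
move=> n0 nodes leaves.
have tP u : (0 < u < n + n)%N -> t u = 0%N \/ (0 < t u <= n)%N /\ P (t u).
  have [m] := ubnP (n + n - u); elim: m u => // m IH u mu uP.
  have [un|nu] := ltnP u n.
    rewrite nodes /best; last lia.
    by case: ifP => _; apply: IH; lia.
  have := leaves (u - n).+1; have -> : (n + (u - n).+1 - 1)%N = u by lia.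
  case: ifP => Pj ->; [|lia|by left|lia].
  by right; split=> //; lia.
have up u : (0 < u < n + n)%N -> (0 < t u)%N ->
    (0 < t 1%N)%N /\ lexle y (t 1%N) (t u).
  elim/ltn_ind: u => u IH uP tu.
  have [u1|u1] := eqVneq u 1%N.
    by rewrite u1 in tu *; split=> //; apply: lexle_refl.
  have [par_pos par_le] : (0 < t u./2)%N /\ lexle y (t u./2) (t u).
    rewrite (nodes u./2); last lia.
    have [uE|uE] : (u./2 + u./2)%N = u \/ (u./2 + u./2 + 1)%N = u by lia.
      by rewrite uE; apply: best_left.
    by rewrite uE; apply: best_right.
  have [|||top_pos top_le] := IH u./2; [lia|lia|done|].
  by split=> //; apply: lexle_trans par_le.
have [t10|[t1P PtP]] := tP 1%N ltac:(lia).
  left; split=> // j jP; apply/negP => Pj.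
  by have := up (n + j - 1)%N; rewrite leaves // Pj t10; lia.
right; split=> // j jP Pj; have := up (n + j - 1)%N; rewrite leaves // Pj.
by case; [lia|lia|].
Qed.

End Tournament.

(** * Building and repairing the tree *)

Definition build : cmd :=
  Seq (setvar 2 NSize)
      (While (BNle (NConst 2) (var 2))
             (Seq (setvar 2 (NSub (var 2) (NConst 1))) play)).

Definition climb : cmd :=
  While (BNle (NConst 2) (var 2)) (Seq (setvar 2 (NHalf (var 2))) play).

Definition arr R (st : state R) (c j : nat) : nat := nmem st (cell c j).
Arguments arr : simpl never.

Section TournamentPrograms.
Variables (R : realFieldType) (n : nat) (q z : nat -> R) (K : R).

Notation wp := (@wp R n q z K).

Definition ykey (st : state R) (i : nat) : R := zavg z i (arr st 1 i).

Definition tree_frame (st st' : state R) : Prop :=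
  (forall c j, (c < 4)%N -> ~~ ((c == 0) && (j == 2))%N ->
     ~~ ((c == 3) && (j < n))%N -> arr st' c j = arr st c j) /\
  rmem st' = rmem st.

Lemma neval_var m k : neval n m (var k) = m (cell 0 k).
Proof. by []. Qed.

Lemma lex_ltbE st d e :
  beval n q z K st (lex_ltb d e) =
  ~~ lexle (ykey st) (neval n (nmem st) e) (neval n (nmem st) d).
Proof.
rewrite /lexle /= !neval_ld -!/(arr _ _ _) -!/(ykey _ _) negb_and -ltNge.
by case: ltgtP; rewrite /= ?andbT.
Qed.

Opaque lex_ltb.

Lemma wp_play (Q : state R -> nat -> Prop) st :
  let u := arr st 0 2 in
  Q (State (nupd (nmem st) (cell 3 u)
              (best (ykey st) (arr st 3 (u + u)) (arr st 3 (u + u + 1))))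
           (rmem st)) 2%N ->
  wp play Q st.
Proof.
move=> u; rewrite /best => Qs.
apply: wp_if; rewrite [beval _ _ _ _ _ _]/= lex_ltbE !neval_ld -/(arr _ _ _) => test;
  apply: wp_nstore; rewrite neval_ncell neval_ld /=.
  by rewrite test in Qs.
by rewrite (negbTE test) in Qs.
Qed.

Lemma arr_nupd f (r : nat -> R) c i v c' j : (c < 4)%N -> (c' < 4)%N ->
  arr (State (nupd f (cell c i) v) r) c' j =
  if (c' == c) && (j == i) then v else arr (State f r) c' j.
Proof. exact: nupd_cell. Qed.

Lemma tree_frame_trans {st1 st2 st3} :
  tree_frame st1 st2 -> tree_frame st2 st3 -> tree_frame st1 st3.
Proof.
move=> [n12 r12] [n23 r23]; split=> [c j c4 cj1 cj2|]; last by rewrite r23.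
by rewrite n23 // n12.
Qed.

Lemma tree_frame_ykey {st st'} : tree_frame st st' -> ykey st' =1 ykey st.
Proof. by move=> [fr _] i; rewrite /ykey fr. Qed.

(** [P] marks the nodes known to be up to date, so that a tree under construction or repair can be
    described. *)
Definition nodes_ok (st : state R) (P : pred nat) : Prop :=
  forall u, (0 < u < n)%N -> P u -> node_ok (ykey st) (arr st 3) u.

Lemma nodes_ok_subset {st} {P P' : pred nat} :
  (forall u, (0 < u < n)%N -> P' u -> P u) -> nodes_ok st P -> nodes_ok st P'.
Proof. by move=> PP' ok u uP /PP' Pu; apply: ok; rewrite ?Pu. Qed.

Lemma best_ext {y1 y2 : nat -> R} i j : y1 =1 y2 -> best y1 i j = best y2 i j.
Proof. by move=> eq_y; rewrite /best /lexle !eq_y. Qed.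

(** Replaying node [u] can invalidate only its parent, so [P'] may add [u] to [P] but must exclude
    that parent. *)
Lemma wp_refresh e u st (P P' : pred nat) :
  u = neval n (nmem st) e -> (0 < u < n)%N -> nodes_ok st P ->
  (forall v, (0 < v < n)%N -> P' v -> [/\ (v == u) || P v, v + v != u & v + v + 1 != u]%N) ->
  wp (Seq (setvar 2 e) play)
    (fun st' k => [/\ tree_frame st st', nodes_ok st' P', arr st' 0 2 = u & k = 3]%N) st.
Proof.
move=> uE uP ok PP'; apply/wp_seq/wp_nstore/wp_play; rewrite neval_ncell -uE.
set s1 := State (nupd _ _ u) _.
have arr1 c j : (c < 4)%N ->
    arr s1 c j = if (c == 0) && (j == 2)%N then u else arr st c j.
  by move=> c4; rewrite arr_nupd.
rewrite (best_ext (y2 := ykey st)) ?arr1 //=; last first.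
  by move=> i; rewrite /ykey arr1.
set st' := State _ _.
have arrE c j : (c < 4)%N -> ~~ ((c == 0) && (j == 2))%N ->
    arr st' c j = if (c == 3) && (j == u) then
      best (ykey st) (arr st 3 (u + u)) (arr st 3 (u + u + 1)) else arr st c j.
    by move=> c4 cj; rewrite /st' !arr_nupd // (negbTE cj).
have fr : tree_frame st st'.
  split=> // c j c4 cj1 cj2; rewrite arrE //.
  by move: cj2; case: (c == 3)%N => //=; case: eqP => // ->; lia.
split=> //; last by rewrite !arr_nupd.
move=> v vP P'v; have [vu v1 v2] := PP' v vP P'v.
rewrite /node_ok !arrE //= (negbTE v1) (negbTE v2).
rewrite (best_ext _ _ (tree_frame_ykey fr)).
by case: eqP vu => [->|] //= _; apply: ok.
Qed.

Lemma wp_build st :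
  wp build (fun st' k =>
    [/\ tree_frame st st', nodes_ok st' predT & (k <= 4 * n + 2)%N]) st.
Proof.
apply/wp_seq/wp_nstore; rewrite neval_ncell /=.
(* Nodes are replayed in decreasing order, so a parent invalidated by a replay is still to be
   replayed. A replay and its loop test cost four units. *)
pose I s e := [/\ tree_frame st s, nodes_ok s (leq (arr s 0 2)),
                  (arr s 0 2 <= n)%N & e = (4 * arr s 0 2)%N].
apply: (wp_while I).
- move=> s e [fr ok vn ->] /=; rewrite neval_var -/(arr _ _ _) => v2.
  apply: (wp_weaken (wp_refresh (u := (arr s 0 2 - 1)%N) (P' := leq (arr s 0 2 - 1)) _ _ ok _)) => //.
  + lia.
  + by move=> v vP vv; split; lia.
  move=> s' k [fr' ok' vE ->]; exists (4 * arr s' 0 2)%N; split; last by rewrite vE; lia.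
  by split; rewrite ?vE; [exact: tree_frame_trans fr'|exact: ok'|lia|lia].
- have vE : arr (State (nupd (nmem st) (cell 0 2) n) (rmem st)) 0 2 = n.
    by rewrite arr_nupd.
  split; rewrite ?vE //; last by move=> u uP; lia.
  by split=> // c j c4 cj _; rewrite arr_nupd // (negbTE cj).
- move=> s e k [fr ok vn ->] /=; rewrite neval_var -/(arr _ _ _) => v2 ke.
  split=> //; last lia.
  by apply: nodes_ok_subset ok => u uP _; lia.
Qed.

Lemma wp_climb st l : (0 < arr st 0 2 < n + n)%N -> (arr st 0 2 < 2 ^ l.+1)%N ->
  nodes_ok st (fun u => u != (arr st 0 2)./2) ->
  wp climb (fun st' k =>
    [/\ tree_frame st st', nodes_ok st' predT & (k <= 4 * l + 1)%N]) st.
Proof.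
move=> vP vl ok.
(* Only the parent of the current node may be out of date; at the root that parent is 0, which is
   not a node. [l'] bounds the levels left. *)
pose I s e := exists l', [/\ tree_frame st s, nodes_ok s (fun u => u != (arr s 0 2)./2),
  (0 < arr s 0 2 < n + n)%N, (arr s 0 2 < 2 ^ l'.+1)%N & e = (4 * l')%N].
apply: (@wp_while _ _ _ _ _ I _ _ _ _ (4 * l)%N); last 1 first.
- move=> s e k [l' [fr ok' vP' vl' _]] /=; rewrite neval_var -/(arr _ _ _) => v2 ke.
  split=> //; last lia.
  by apply: nodes_ok_subset ok' => u uP _; lia.
- move=> s e [l' [fr ok' vP' vl' ->]] /=; rewrite neval_var -/(arr _ _ _) => v2.
  case: l' vl' => [|l'] vl'; first by rewrite expn1 in vl'; lia.
  apply: (wp_weaken (wp_refresh (u := (arr s 0 2)./2)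
           (P' := fun v => v != (arr s 0 2)./2./2) _ _ ok' _)) => //.
  + lia.
  + by move=> v vP1 vv; split; lia.
  move=> s' k [fr' ok1 vE ->]; exists (4 * l')%N; split; last lia.
  exists l'; split; rewrite ?vE //; first exact: tree_frame_trans fr'.
    lia.
  by move: vl'; rewrite (expnS _ l'.+1); lia.
- by exists l.
Qed.

End TournamentPrograms.

(** * First phase *)

(** The candidates absorbed by [i] are the children of [i], so parents and lengths are obtained
    along with [b i]. *)
Definition absorb : cmd :=
  While (BAnd (BNle (var 1) NSize)
              (BRle (RAvg (var 0) (var 1)) (RAvg (var 1) (ld 1 (var 1)))))
    (Seq (NStore (ncell 2 (var 1)) (var 0))
    (Seq (RStore (len_cell (var 0))
                 (RAdd (RLoad (len_cell (var 0))) (RLoad (len_cell (var 1)))))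
         (setvar 1 (ld 1 (var 1))))).

Definition sweep : cmd :=
  Seq (setvar 0 NSize)
    (While (nonzero (var 0))
      (Seq (setvar 1 (NAdd (var 0) (NConst 1)))
      (Seq (RStore (len_cell (var 0)) ROne)
      (Seq (NStore (ncell 3 (NSub (NAdd NSize (var 0)) (NConst 1))) (var 0))
      (Seq absorb
      (Seq (NStore (ncell 1 (var 0)) (var 1))
           (setvar 0 (NSub (var 0) (NConst 1))))))))).

Section Sweep.
Variables (R : realFieldType) (n : nat) (q z : nat -> R) (K : R).

Notation wp := (@wp R n q z K).
Let b := alg2_b n z.

(* [p j] is the largest [k >= i] with [k < j < b k], or [0] if there is none,
   where [c] stands for the value reached so far by [b i]. *)
Definition parent_inv (p : nat -> nat) (i c : nat) : Prop :=
  [/\ forall j, (i < j <= n)%N -> (0 < p j)%N ->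
        (i <= p j < j)%N /\ (j < if p j == i then c else b (p j))%N,
      forall j, (i < j < c)%N -> (0 < p j)%N,
      forall k j, (i < k <= n)%N -> (i < j <= n)%N -> j != k ->
        (k <= j < b k)%N = (k <= p j < b k)%N
    & forall j, (j <= i)%N -> p j = 0%N].

Lemma parent_inv_ext {p p' i c} :
  p =1 p' -> parent_inv p i c -> parent_inv p' i c.
Proof.
move=> eq_p [p1 p2 p3 p4]; split=> [j|j|k j|j]; rewrite -eq_p;
  [exact: p1|exact: p2|exact: p3|exact: p4].
Qed.

Lemma b_nested {i k} : (0 < i <= n)%N -> (i <= k < b i)%N -> (b k <= b i)%N.
Proof. by move=> iP kP; have [/(_ k kP)[]] := alg2_nested z iP. Qed.

(** No interval starting strictly between [i] and [c] reaches past [c], so [i] is the parent of [c].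
    Indices strictly between [c] and [b c] already have one: the third clause at [c] puts it into
    [[c, b c)]. *)
Lemma parent_absorb {p p' i c} : (0 < i < c)%N -> (c <= n)%N ->
  (forall k, (i < k < c)%N -> (b k <= c)%N) ->
  (forall j, p' j = if j == c then i else p j) ->
  parent_inv p i c -> parent_inv p' i (b c).
Proof.
move=> ic cn bc p'E [p1 p2 p3 p4].
have [bcP _] : (c < b c <= n.+1)%N /\ b c = jump n z n b c c.+1 by apply: alg2_bP; lia.
split=> [j jP|j jP|k j kP jP jk|j ji]; rewrite p'E.
- case: eqP => [-> _|_ pj]; first by rewrite eqxx; lia.
  have [pP1] := p1 j jP pj; case: eqP => // _; lia.
- case: eqP => [_|/eqP jc]; first by lia.
  have [jc'|cj] := ltnP j c; first by apply: p2; lia.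
  by have := p3 c j; lia.
- case: eqP => [jc|_]; last exact: p3.
  have := bc k; lia.
- by case: eqP => [?|_]; [lia|apply: p4].
Qed.

(** The new case is the third clause at [k = i]: the parent of an index inside [[i, b i)] is at
    least [i], and conversely a parent inside confines its children there by nestedness. *)
Lemma parent_close {p i} : (0 < i <= n)%N ->
  parent_inv p i (b i) -> parent_inv p (i - 1) i.
Proof.
move=> iP [p1 p2 p3 p4].
split=> [j jP pj|j jP|k j kP jP jk|j ji]; [|lia| |by apply: p4; lia].
  have [ji|ji] := eqVneq j i; first by rewrite ji p4 in pj.
  have [||pjP pj_b] := p1 j; [lia|by []|].
  split; [lia|rewrite ifN_eq; last lia].
  by move: pj_b; case: eqP => // ->.
have [ji|ji] := eqVneq j i; first by rewrite ji p4; lia.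
have [ki|ki] := eqVneq k i; last by apply: p3; lia.
rewrite {}ki {k kP} in jk *; apply/idP/idP => H.
  have pj : (0 < p j)%N by apply: p2; lia.
  by have [] := p1 j _ pj; lia.
have [||_] := p1 j; [lia|lia|].
by case: eqP => pji jb; have := b_nested (k := p j) iP; lia.
Qed.

Lemma iterb_pos c l : iter l b c = n.+1 -> (c <= n)%N -> (0 < l)%N.
Proof. by case: l => //= ->; rewrite ltnn. Qed.

(** A jump costs four units and shortens the chain from the candidate to [n.+1] by one, so the cost
    is four times the decrease in length, plus the failing test. *)
Lemma wp_absorb st i l :
  (0 < i <= n)%N ->
  arr st 0 0 = i -> arr st 0 1 = i.+1 ->
  (forall j, (i < j <= n)%N -> arr st 1 j = b j) ->
  (forall j, (i < j <= n)%N -> rmem st (n + 2 + j)%N = (b j - j)%:R) ->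
  rmem st (n + 2 + i)%N = 1 ->
  parent_inv (arr st 2) i i.+1 ->
  iter l b i.+1 = n.+1 ->
  wp absorb (fun st' k =>
    [/\ forall c j, (c < 4)%N -> c != 2%N -> ~~ ((c == 0) && (j == 1))%N ->
          arr st' c j = arr st c j,
        forall a, a != (n + 2 + i)%N -> rmem st' a = rmem st a,
        rmem st' (n + 2 + i)%N = (b i - i)%:R,
        arr st' 0 1 = b i /\ parent_inv (arr st' 2) i (b i) &
        exists2 l', iter l' b (b i) = n.+1 & (k + 4 * l' <= 4 * l + 1)%N]) st.
Proof.
move=> iP v0 v1 bE lenE len_i pE lE.
pose I (s : state R) e := exists c f l',
  [/\ [/\ arr s 0 1 = c, (i < c <= n.+1)%N, (n.+1 <= f + c)%N, jump n z f b i c = b i &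
          forall k, (i < k < c)%N -> (b k <= c)%N],
      parent_inv (arr s 2) i c,
      forall c j, (c < 4)%N -> c != 2%N -> ~~ ((c == 0) && (j == 1))%N ->
          arr s c j = arr st c j,
      (forall a, a != (n + 2 + i)%N -> rmem s a = rmem st a) /\
      rmem s (n + 2 + i)%N = (c - i)%:R &
      iter l' b c = n.+1 /\ e = (4 * l')%N].
apply: (@wp_while _ _ _ _ _ I _ _ _ _ (4 * l)%N).
- move=> s e [c [f [l' [[cE cP fc jE bc] ps frs [rs lens] [l'E ->]]]]].
  rewrite /= !neval_ld /= -![nmem _ _]/(arr s _ _) cE (frs 0 0)%N // v0.
  move=> /andP[cn le_avg].
  have cP' : (i < c <= n)%N by lia.
  rewrite (frs 1 c)%N // bE // in le_avg.
  have [bcP _] : (c < b c <= n.+1)%N /\ b c = jump n z n b c c.+1.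
    by apply: alg2_bP; lia.
  have l'0 := iterb_pos l'E cn.
  apply/wp_seq/wp_nstore/wp_seq/wp_rstore/wp_nstore.
  rewrite !neval_ncell /= !neval_ld /= !nupd_cell //= ?neval_var.
  rewrite -![nmem s _]/(arr s _ _) cE (frs 0 0)%N // v0 (frs 1 c)%N // bE //.
  set s' := State _ _.
  have arrE d j : (d < 4)%N -> arr s' d j =
      if (d == 0) && (j == 1)%N then b c else
      if (d == 2) && (j == c)%N then i else arr s d j.
    by move=> d4; rewrite !arr_nupd.
  exists (4 * l'.-1)%N; split; last lia.
  exists (b c), f.-1, l'.-1; split; rewrite ?arrE //=.
  + split=> //; [lia|lia| |].
      case: (f) fc jE => [|f'] /= fc; first lia.
      by rewrite le_avg (_ : c != n.+1); last lia.
    move=> k kP; have [kc|ck] := ltnP k c; first by have := bc k; lia.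
    by apply: b_nested; lia.
  + apply: parent_absorb ps => // [|j]; first lia.
    by rewrite arrE.
  + move=> d j d4 d2 dj; rewrite arrE // (negbTE dj) (negbTE d2) /=.
    exact: frs.
  + split=> [a aP|]; rewrite /s' /= /rupd.
      by rewrite (negbTE aP) rs.
    rewrite eqxx lens rs ?lenE //; last lia.
    by rewrite -natrD; congr _%:R; lia.
  + by split=> //; rewrite -l'E; case: (l') l'0 => // l'' _; rewrite iterSr.
- exists i.+1, n, l; split=> //; first split=> //; try lia.
  + by rewrite -(alg2_bP z iP).2.
  + by split=> //; rewrite len_i subSnn.
- move=> s e k [c [f [l' [[cE cP fc jE bc] ps frs [rs lens] [l'E ->]]]]].
  rewrite /= !neval_ld /= -![nmem _ _]/(arr s _ _) cE (frs 0 0)%N // v0 => test kl.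
  have cb : c = b i.
    rewrite -jE; case: (f) => //= f'; case: ifP => // /andP[cn le_avg].
    by move: test; rewrite (frs 1 c)%N // bE ?le_avg; lia.
  subst c; split=> //.
  + by rewrite lens cb.
  + by rewrite -cb.
  + by exists l'; rewrite -?cb //; lia.
Qed.

Lemma wp_sweep :
  wp sweep (fun st k =>
    [/\ forall j, arr st 1 j = if (0 < j <= n)%N then b j else 0%N,
        forall j, (0 < j <= n)%N -> arr st 3 (n + j - 1) = j,
        forall j, (0 < j <= n)%N -> rmem st (n + 2 + j)%N = (b j - j)%:R,
        rmem st 0%N = 0 /\ parent_inv (arr st 2) 0 1
      & (k <= 11 * n + 2)%N]) (init_state 0).
Proof.
apply/wp_seq/wp_nstore; rewrite neval_ncell /=.
(* Eleven units per index: seven for five assignments, its loop test and the failing test of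
   [absorb], and four for the element it adds to the chain. *)
pose I (s : state R) e := exists i l,
  [/\ [/\ arr s 0 0 = i, (i <= n)%N, iter l b i.+1 = n.+1 & e = (4 * l + 11 * i)%N],
      forall j, arr s 1 j = if (i < j <= n)%N then b j else 0%N,
      forall j, (i < j <= n)%N -> arr s 3 (n + j - 1) = j,
      forall j, (i < j <= n)%N -> rmem s (n + 2 + j)%N = (b j - j)%:R
    & rmem s 0%N = 0 /\ parent_inv (arr s 2) i i.+1].
apply: (@wp_while _ _ _ _ _ I _ _ _ _ (11 * n)%N).
- move=> s e [i [l [[iE i_n lE ->] bE tE lenE [s0 pE]]]].
  rewrite /= !neval_ld /= -![nmem _ _]/(arr s _ _) iE => i0.
  apply/wp_seq/wp_nstore/wp_seq/wp_rstore/wp_seq/wp_nstore/wp_seq.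
  rewrite !neval_ncell /= !neval_ld /= !nupd_cell //=.
  rewrite -![nmem s _]/(arr s _ _) iE addn1.
  set s1 := State _ _.
  have arr1 c j : (c < 4)%N -> arr s1 c j =
      if (c == 3) && (j == n + i - 1)%N then i else
      if (c == 0) && (j == 1)%N then i.+1 else arr s c j.
    by move=> c4; rewrite !arr_nupd.
  apply: (wp_weaken (wp_absorb (i := i) (l := l) _ _ _ _ _ _ _ _)) => //.
  + lia.
  + by rewrite arr1.
  + by rewrite arr1.
  + by move=> j jP; rewrite arr1 // bE jP.
  + by move=> j jP; rewrite /s1 /= /rupd; case: eqP => [|_]; [lia|apply: lenE].
  + by rewrite /s1 /= /rupd eqxx.
  + by apply: parent_inv_ext pE => j; rewrite arr1.
  move=> s2 k [frs rs len_i [cE p2] [l' l'E kl]].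
  apply/wp_seq/wp_nstore/wp_nstore.
  rewrite !neval_ncell /= !neval_ld /= !nupd_cell //=.
  rewrite -![nmem s2 _]/(arr s2 _ _) cE (frs 0 0)%N // arr1 //= iE.
  set s3 := State _ _.
  have arr3 c j : (c < 4)%N -> arr s3 c j =
      if (c == 0) && (j == 0)%N then (i - 1)%N else
      if (c == 1) && (j == i)%N then b i else arr s2 c j.
    by move=> c4; rewrite !arr_nupd.
  exists (4 * l'.+1 + 11 * (i - 1))%N; split; last lia.
  exists (i - 1)%N, l'.+1; split.
  + split=> //; first lia.
    by rewrite (_ : (i - 1).+1 = i) ?iterSr //; lia.
  + move=> j; rewrite arr3 //=; case: eqP => [->|ji]; first by rewrite ifT //; lia.
    by rewrite frs // arr1 //= bE; congr (if _ then _ else _); lia.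
  + move=> j jP; rewrite arr3 //= frs // arr1 //=.
    by case: eqP => [|?]; [lia|rewrite tE; lia].
  + move=> j jP; rewrite /s3 /=; have [->//|ji] := eqVneq j i.
    rewrite rs; last lia.
    by rewrite /s1 /= /rupd; case: eqP => [|_]; [lia|apply: lenE; lia].
  + split; first by rewrite /s3 /= rs ?/s1 /= /rupd; [case: eqP => //; lia|lia].
    rewrite (_ : (i - 1).+1 = i); last lia.
    apply: parent_inv_ext (parent_close _ p2) => [j|]; last lia.
    by rewrite arr3.
- exists n, 0%N; split=> //.
  + by move=> j; rewrite arr_nupd //= [RHS]ifF //; lia.
  + by move=> j; lia.
  + by move=> j; lia.
  + split=> //; split; try by move=> j; lia.
    by move=> j _; rewrite arr_nupd.
- move=> s e k [i [l [[iE i_n lE ->] bE tE lenE [s0 pE]]]].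
  rewrite /= !neval_ld /= -![nmem _ _]/(arr s _ _) iE => test kl.
  have i0 : i = 0%N by lia.
  by subst i; rewrite i0 in bE tE lenE pE kl; split=> //; lia.
Qed.

End Sweep.

(** * Second phase *)

Definition budget : nexp := NAdd NSize (NConst 1).
Definition delta : nexp := NAdd NSize (NConst 2).
Definition weight : rexp := RMul (RLoad (len_cell (var 3))) (yexp (var 3)).
(** An index about to be selected still has the value of its parent, so the cell of the parent is
    read. *)
Definition gap : rexp := RSub (RQ (var 3)) (RLoad (ld 2 (var 3))).

(** Once the budget is exhausted the rounds go on with increment 0, because the unselected indices
    must still receive the values of their parents. *)
Definition spend : cmd :=
  If (BRlt RZero (RLoad budget))
     (Seq (If (BRlt (RDiv (RLoad budget) weight) gap)
              (RStore delta (RDiv (RLoad budget) weight))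
              (RStore delta gap))
          (RStore budget (RSub (RLoad budget) (RMul (RLoad delta) weight))))
     (RStore delta RZero).

Definition round : cmd :=
  Seq (setvar 3 (ld 3 (NConst 1)))
  (Seq spend
  (Seq (RStore (var 3) (RAdd (RLoad (ld 2 (var 3))) (RLoad delta)))
  (Seq (setvar 2 (NSub (NAdd NSize (var 3)) (NConst 1)))
  (Seq (NStore (ncell 3 (var 2)) (NConst 0))
       climb)))).

Definition rounds : cmd :=
  Seq (RStore budget RK) (While (nonzero (ld 3 (NConst 1))) round).

Definition alg2_program : cmd := Seq sweep (Seq build rounds).

Section Rounds.
Variables (R : realFieldType) (n : nat) (q z : nat -> R) (K : R).

Notation wp := (@wp R n q z K).
Let b := alg2_b n z.
Let y := alg2_y n z.

Lemma phase2_stop f B S x : ~~ (0 < B) -> phase2 n q z f B S x = x.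
Proof. by case: f => //= f /negbTE->. Qed.

Lemma phase2_done f B S x : live n S = [::] -> phase2 n q z f B S x = x.
Proof. by case: f => //= f /argmin_y_None ->; case: ifP. Qed.

Lemma wp_spend st M :
  arr st 0 3 = M ->
  let B := rmem st (n + 1)%N in
  let w := rmem st (n + 2 + M)%N * ykey z st M in
  let d := if 0 < B then Num.min (B / w) (q M - rmem st (arr st 2 M)) else 0 in
  (0 < M)%N -> (arr st 2 M <= n)%N ->
  wp spend (fun st' k =>
    [/\ nmem st' = nmem st,
        rmem st' (n + 1)%N = B - d * w, rmem st' (n + 2)%N = d,
        forall a, (a <= n)%N -> rmem st' a = rmem st a /\
                  ((0 < a)%N -> rmem st' (n + 2 + a)%N = rmem st (n + 2 + a)%N)
      & (k <= 4)%N]) st.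
Proof.
move=> ME B w d M0 pM.
pose s' := rupd (rmem st) (n + 2) d.
have s'B : s' (n + 1)%N = B by rewrite /s' /rupd ifN_eq //; lia.
have s'w : s' (n + 2 + M)%N = rmem st (n + 2 + M)%N.
  by rewrite /s' /rupd ifN_eq //; lia.
have s'd : s' (n + 2)%N = d by rewrite /s' /rupd eqxx.
have s'E a : (a <= n)%N -> s' a = rmem st a /\
    ((0 < a)%N -> s' (n + 2 + a)%N = rmem st (n + 2 + a)%N).
  by move=> an; rewrite /s' /rupd; split=> [|a0]; rewrite ifN_eq //; lia.
(* The budget update, common to both branches of the minimum. *)
have finish k : (k <= 2)%N ->
  wp (RStore budget (RSub (RLoad budget) (RMul (RLoad delta) weight)))
   (fun st' k' => [/\ nmem st' = nmem st,
        rmem st' (n + 1)%N = B - d * w, rmem st' (n + 2)%N = d,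
        forall a, (a <= n)%N -> rmem st' a = rmem st a /\
                  ((0 < a)%N -> rmem st' (n + 2 + a)%N = rmem st (n + 2 + a)%N)
      & ((k + k').+1 <= 4)%N]) (State (nmem st) s').
  move=> k2; apply: wp_rstore.
  rewrite /= !neval_ld /= -![nmem _ _]/(arr st _ _) ME s'B s'd s'w.
  rewrite -/(ykey z st M) -/w /rupd eqxx ifN_eq ?s'd; last lia.
  split=> //; last lia.
  move=> a an; have [<- H] := s'E a an; split=> [|a0].
    by rewrite ifN_eq //; lia.
  by rewrite ifN_eq ?H //; lia.
apply: wp_if; rewrite /= -/B.
  move=> B0; apply/wp_seq/wp_if; rewrite /= !neval_ld /= -![nmem _ _]/(arr st _ _) ME.
    rewrite -/(ykey z st M) -/w -/B => lt_d; apply: wp_rstore.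
    rewrite /= !neval_ld /= -![nmem _ _]/(arr st _ _) ME -/(ykey z st M) -/w -/B.
    have -> : B / w = d by rewrite /d B0 /Num.min /Order.min lt_d.
    exact: finish.
  rewrite -/(ykey z st M) -/w -/B => lt_d; apply: wp_rstore.
  rewrite /= !neval_ld /= -![nmem _ _]/(arr st _ _) ME.
  have -> : q M - rmem st (arr st 2 M) = d by rewrite /d B0 /Order.min (negbTE lt_d).
  exact: finish.
move=> B0; apply: wp_rstore; rewrite /=.
have d0 : d = 0 by rewrite /d (negbTE B0).
rewrite -d0 -/s' s'B s'd; split=> //.
by rewrite d0 mul0r subr0.
Qed.

(** Relates memory to a state [S], [x] of the algorithm with fuel [f]. Memory holds [x] at selected
    indices only; the other values are implicit through parents. By [inv_alg2], resuming the
    algorithm here yields its output; after exhaustion [S] still grows while [x] stays. *)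
Record rounds_inv (st : state R) (S : nat -> bool) (x : nat -> R) (f : nat) : Prop := {
  inv_b : forall j, arr st 1 j = if (0 < j <= n)%N then b j else 0%N;
  inv_len : forall j, (0 < j <= n)%N -> rmem st (n + 2 + j)%N = (b j - j)%:R;
  inv_parent : parent_inv n z (arr st 2) 0 1;
  inv_rmem0 : rmem st 0%N = 0;
  inv_x0 : x 0%N = 0;
  inv_nodes : nodes_ok n z st predT;
  inv_leaf : forall j, (0 < j <= n)%N ->
    arr st 3 (n + j - 1) = if ~~ S j then j else 0%N;
  inv_done : forall j, (0 < j <= n)%N -> S j -> rmem st j = x j;
  inv_todo : forall j, (0 < j <= n)%N -> ~~ S j -> x j = x (arr st 2 j);
  inv_anc : forall i j, (0 < i)%N -> (i <= j < b i)%N -> (j <= n)%N -> S j -> S i;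
  inv_alg2 : forall j, (0 < j <= n)%N ->
    phase2 n q z f (rmem st (n + 1)%N) S x j = alg2 n q z K j;
  inv_fuel : (size (live n S) <= f)%N
}.

Lemma wp_round st S x f : rounds_inv st S x f -> (0 < n)%N -> (0 < arr st 3 1)%N ->
  wp round (fun st' k =>
    (exists S' x' f', rounds_inv st' S' x' f' /\
      (size (live n S') < size (live n S))%N) /\
    (k <= 4 * (trunc_log 2 n).+1 + 9)%N) st.
Proof.
move=> [bE lenE pE r0 x0 nodes leaf doneE todoE anc refE fuel] n_gt0.
have [[-> //]|[MP MS Mmin] _] :=
  tournament_winner (P := fun j => ~~ S j) n_gt0 (fun u uP => nodes u uP isT) leaf.
move ME : (arr st 3 1) MP MS Mmin => M MP MS Mmin.
have yE j : (0 < j <= n)%N -> ykey z st j = y j.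
  by move=> jP; rewrite /ykey bE jP.
have M_live : M \in live n S by rewrite mem_live MS.
have argE : argmin_y n z S = Some M.
  apply: argmin_yP => // j; rewrite mem_live => /andP[jS jP].
  by have := Mmin j jP jS; rewrite /lexle !yE.
(* An interval around [M] starts at a smaller index with no larger [y]; were that index live, it
   would precede [M]. *)
have anc_M i : (0 < i < M)%N -> (M < b i)%N -> S i.
  move=> iP Mb; apply/negPn/negP => iS.
  have iP' : (0 < i <= n)%N by lia.
  have := Mmin i iP' iS; rewrite /lexle !yE // => /andP[_ /implyP yM].
  have [nested _] := alg2_nested z iP'.
  have iM : (i <= M < b i)%N by lia.
  by have [_ /yM] := nested M iM; lia.
have [p1 _ p3 _] := pE.
pose p := arr st 2; rewrite -!/p in pE p1 p3 todoE.
have pM_lt : (p M < M)%N.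
  by case: (posnP (p M)) => [->|pM]; [lia|have [] := p1 M MP pM; lia].
have xpM : x M = rmem st (p M).
  rewrite todoE //; case: (posnP (p M)) => [->|pM]; first by rewrite x0 r0.
  rewrite doneE //; first lia.
  apply: anc_M; first lia.
  by have [_] := p1 M MP pM; rewrite ifN_eq //; lia.
have bM : (M < b M)%N by have [/andP[]] := alg2_bP z MP.
apply/wp_seq/wp_nstore/wp_seq; rewrite neval_ncell neval_ld /= -/(arr _ _ _) ME.
set s1 := State _ _.
have arr1 c j : (c < 4)%N ->
    arr s1 c j = if (c == 0) && (j == 3)%N then M else arr st c j.
  by move=> c4; rewrite arr_nupd.
have y1 j : (0 < j <= n)%N -> ykey z s1 j = y j.
  by move=> jP; rewrite /ykey arr1 //= -/(ykey z st j) yE.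
apply: wp_weaken (wp_spend (M := M) _ _ _) _; [by rewrite arr1|lia| |].
  by rewrite arr1 //= -/p; lia.
have r1 : rmem s1 = rmem st by [].
rewrite !{}r1 arr1 // y1 //.
rewrite (lenE M MP) /= -/p -xpM.
set B := rmem st (n + 1)%N; set w := _%:R * y M; set d := if _ then _ else _.
move=> s2 k [nm2 B2 d2 r2 k4].
have arr2 c j : arr s2 c j = arr s1 c j by rewrite /arr nm2.
apply/wp_seq/wp_rstore/wp_seq/wp_nstore/wp_seq/wp_nstore.
rewrite !neval_ncell /= !neval_ld /= !nupd_cell //= ?neval_var.
rewrite -![nmem s2 _]/(arr s2 _ _) !arr2 !arr1 //= -/(p M) d2.
rewrite (r2 (p M) _).1; last lia.
rewrite -xpM; set s3 := State _ _.
have arr3 c j : (c < 4)%N -> arr s3 c j =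
    if (c == 3) && (j == n + M - 1)%N then 0%N else
    if (c == 0) && (j == 2)%N then (n + M - 1)%N else
    if (c == 0) && (j == 3)%N then M else arr st c j.
  by move=> c4; rewrite !arr_nupd // -[arr (State _ _) _ _]/(arr s2 c j) arr2 arr1.
have y3 : ykey z s3 =1 ykey z st by move=> j; rewrite /ykey arr3.
have v3 : arr s3 0 2 = (n + M - 1)%N by rewrite arr3.
(* The leaf [n + M - 1] is below [2 n], hence below [2 ^ (trunc_log 2 n).+2]. *)
apply: wp_weaken (wp_climb (l := (trunc_log 2 n).+1) _ _ _ _ _) _; rewrite ?v3.
- lia.
- by have := trunc_log_ltn n (isT : 1 < 2)%N; rewrite !expnS; lia.
- move=> u uP uM; rewrite /node_ok !arr3 //= !ifN_eq; [|lia..].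
  by rewrite (best_ext _ _ y3); apply: nodes.
move=> s4 k' [[fr4 r4] nodes4 k'P]; split; last lia.
have p4 j : arr s4 2 j = p j by rewrite fr4 // arr3.
have r4E a : (a <= n)%N -> rmem s4 a = if a == M then x M + d else rmem st a.
  by move=> an; rewrite r4 /s3 /= /rupd (r2 a an).1.
pose x' j := if (M <= j < b M)%N then x j + d else x j.
pose S' j := S j || (j == M).
case: f refE fuel => [|f] refE fuel; first by case: (live n S) M_live fuel.
exists S', x', f; split; last exact: size_live_remove.
split.
- by move=> j; rewrite fr4 // arr3 //= bE.
- move=> j jP; rewrite r4 /s3 /= /rupd ifN_eq; last lia.
  by rewrite (r2 j _).2 ?lenE //; lia.
- by apply: parent_inv_ext pE => j; rewrite p4.
- by rewrite r4E // ifN_eq //; lia.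
- by rewrite /x' ifF //; lia.
- exact: nodes4.
- move=> j jP; rewrite fr4 //=; last lia.
  rewrite arr3 //= leaf // /S' negb_or andbC.
  have -> : (n + j - 1 == n + M - 1)%N = (j == M) by lia.
  by case: eqP.
(* A previously selected [j] lies outside [[M, b M)], since otherwise [inv_anc] would have [M]
   selected already. *)
- move=> j jP; rewrite /S' /x' r4E; last lia.
  case: eqP => [->|/eqP jM]; first by rewrite leqnn bM.
  rewrite orbF => jS; rewrite ifN; first exact: doneE.
  by apply: contra MS => jMb; apply: (anc M j); lia.
(* By the third clause of [parent_inv], the range update hits [j] exactly when it hits its
   parent. *)
- move=> j jP; rewrite /S' negb_or => /andP[jS jM].
  by rewrite /x' p4 (todoE j jP jS) (p3 M j).
- move=> i j i0 ij jn; rewrite /S' => /orP[jS|/eqP jM].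
    by rewrite (anc i j).
  have [->|iM] := eqVneq i M; first by rewrite orbT.
  by rewrite anc_M //; lia.
- move=> j jP; rewrite r4 /s3 /= /rupd ifN_eq ?B2; last lia.
  rewrite -(refE j jP) /= argE -/B /x'.
  case: ifP => B0; first by rewrite /d B0.
  rewrite /d B0 mul0r subr0 phase2_stop ?B0 //.
  by case: ifP; rewrite // addr0.
- by rewrite -ltnS; apply: leq_trans (size_live_remove M_live) fuel.
Qed.

Lemma wp_rounds st : (0 < n)%N ->
  (forall j, arr st 1 j = if (0 < j <= n)%N then b j else 0%N) ->
  (forall j, (0 < j <= n)%N -> rmem st (n + 2 + j)%N = (b j - j)%:R) ->
  parent_inv n z (arr st 2) 0 1 ->
  rmem st 0%N = 0 ->
  nodes_ok n z st predT ->
  (forall j, (0 < j <= n)%N -> arr st 3 (n + j - 1) = j) ->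
  wp rounds (fun st' k =>
    (forall i, (0 < i <= n)%N -> rmem st' i = alg2 n q z K i) /\
    (k <= (4 * (trunc_log 2 n).+1 + 10) * n + 2)%N) st.
Proof.
move=> n_gt0 bE lenE pE r0 nodes leaf.
apply/wp_seq/wp_rstore; set s0 := State _ _.
(* The bound on one round together with its loop test. *)
set c0 := (_ + 10)%N.
pose I (s : state R) e := exists S x f,
  rounds_inv s S x f /\ e = (c0 * size (live n S))%N.
pose S0 j := (j == 0)%N || (j == n.+1).
have size_live : size (live n S0) = n.
  rewrite /live (eq_in_filter (a2 := predT)) ?filter_predT ?size_iota //.
  by move=> i; rewrite mem_iota /S0 => iP /=; lia.
apply: (@wp_while _ _ _ _ _ I _ _ _ _ (c0 * n)%N).
- move=> s e [S [x [f [inv ->]]]].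
  rewrite /= neval_ld /= -/(arr _ _ _) => t1.
  apply: wp_weaken (wp_round inv n_gt0 t1) _ => s' k [[S' [x' [f' [inv' lt_S]]]] kP].
  exists (c0 * size (live n S'))%N; split; first by exists S', x', f'.
  have : (c0 * (size (live n S')).+1 <= c0 * size (live n S))%N by rewrite leq_mul.
  by rewrite mulnS /c0; lia.
- exists S0, (fun=> 0), n; split; last by rewrite size_live.
  have r0E a : a != (n + 1)%N -> rmem s0 a = rmem st a.
    by move=> an; rewrite /s0 /= /rupd ifN_eq.
  split=> //.
  + by move=> j jP; rewrite r0E ?lenE //; lia.
  + by rewrite r0E //; lia.
  + by move=> j jP; rewrite /arr /= -/(arr st _ _) leaf // ifT // /S0; lia.
  + by move=> j jP; rewrite /S0; lia.
  + by move=> i j i0 ij jn; rewrite /S0; lia.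
  + by move=> j jP; rewrite /s0 /= /rupd eqxx.
  + by rewrite size_live.
- move=> s e k [S [x [f [inv ->]]]].
  rewrite /= neval_ld /= -/(arr _ _ _) => t1 kP; split; last by lia.
  (* An empty root means that every index is selected, so memory holds all of [x] and the algorithm
     has nothing left to do. *)
  have [[_ Sall]|[t1P _ _]] := tournament_winner (P := fun j => ~~ S j) n_gt0
    (fun u uP => inv_nodes inv uP isT) (inv_leaf inv); last by rewrite (andP t1P).1 in t1.
  move=> i iP; rewrite (inv_done inv) //; last by apply/negPn/Sall.
  rewrite -(inv_alg2 inv iP) phase2_done //.
  apply/eqP; rewrite -size_eq0 size_filter -leqn0 leqNgt -has_count; apply/hasPn.
  by move=> j; rewrite mem_iota => jP; apply: Sall; lia.
Qed.

Lemma wp_alg2_program : (0 < n)%N ->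
  wp alg2_program (fun st k =>
    (forall i, (0 < i <= n)%N -> rmem st i = alg2 n q z K i) /\
    (k <= 35 * (n * (trunc_log 2 n).+1))%N) (init_state 0).
Proof.
move=> n_gt0; apply/wp_seq/(wp_weaken (wp_sweep _ _ _ _)).
move=> s1 k1 [bE tE lenE [r0 pE] k1P].
apply/wp_seq/(wp_weaken (wp_build _ _ _ _ _)) => s2 k2 [[fr r2] nodes k2P].
apply: (wp_weaken (wp_rounds _ _ _ _ _ _ _)) => //.
- by move=> j; rewrite fr // bE.
- by move=> j jP; rewrite r2 lenE.
- by apply: parent_inv_ext pE => j; rewrite fr.
- by rewrite r2.
- by move=> j jP; rewrite fr ?tE //; lia.
(* With [L = (trunc_log 2 n).+1] the costs are at most [11 n + 2], [4 n + 2] and [(4 L + 10) n + 2];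
   as [n] and [L] are at least 1, they sum to at most [35 n L]. *)
by move=> s3 k3 [xE k3P]; split=> //; nia.
Qed.

End Rounds.

(* There is a single program P and a constant C such that, on every instance
   of Problem (P) with n variables, P (with unit-cost avg oracle) halts after
   at most C * n * (floor(log2 n) + 1) steps, leaving in real-memory cells
   1..n exactly the output x_1..x_n of Algorithm 2. *)
Theorem theorem5 :
  exists (P : cmd) (C : nat),
  forall (R : realType) (n : nat) (q z : nat -> R) (K : R),
    (1 <= n)%N ->
    (forall i, (1 <= i <= n)%N -> 0 < q i) ->
    (forall i, (1 <= i < n)%N -> q i <= q i.+1) ->
    (forall i, (1 <= i <= n)%N -> 0 < z i) ->
    0 < K ->
    exists (st : state R) (k : nat),
      exec n q z K (init_state 0) P k st /\
      (k <= C * (n * (trunc_log 2 n).+1))%N /\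
      (forall i, (1 <= i <= n)%N -> rmem st i = alg2 n q z K i).
Proof.
exists alg2_program, 35%N => R n q z K n_gt0 _ _ _ _.
have [st [k [ex [xE kP]]]] := wp_alg2_program q z K n_gt0.
by exists st, k.
Qed.
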